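(* Let $n$ be a positive integer with positive divisors $a$ and $b$, let $g:=(a,b)$, and let $c\in\mathbb{Z}_n$. Set $n':=\frac ng$, $a':=\frac ag$ and $b':=\frac bg$. Let $\widetilde m_3$ be the largest divisor of $\frac{n'}{a'b'}$ satisfying $(\widetilde m_3,a'b')=1$. (A) If $2\nmid n'$ or $2\mid a'b'$, then: (1) $N_{n;a,b}(c)>0$ if and only if $g\mid c$ and $(c',a'b')=1$ for $c':=\frac cg$. (2) If $c\neq 0$ and $N_{n;a,b}(c)>0$, then there is a unique ideal $I\subseteq\mathbb{Z}_{n'}$ such that $c'=\frac cg\in I^{\bigstar}$. Moreover, $\mathrm{lead}(I)=(c',\widetilde m_3)$. (3) $\displaystyle (a)^{\bigstar}+(b)^{\bigstar}=\bigcup_{d\mid \widetilde m_3} g(d)^{\bigstar}.$ (B) If $2\mid n'$ and $2\nmid a'b'$, then: (1) $N_{n;a,b}(c)>0$ if and only if $g\mid c$ and $c':=\frac cg$ is an even integer satisfying $(c',a'b')=1$. (2) If $c\neq 0$ and $N_{n;a,b}(c)>0$, then there is a unique ideal $I\subseteq\mathbb{Z}_{n'}$ such that $c'=\frac cg\in I^{\bigstar}$. Moreover, $\mathrm{lead}(I)=(c',\widetilde m_3)$. (3) $\displaystyle (a)^{\bigstar}+(b)^{\bigstar}=\bigcup_{d\mid \widetilde m_3,\ d\text{ even}} g(d)^{\bigstar}.$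
   Context: For integers $x,y$, $(x,y)$ denotes the greatest common divisor. $\mathbb{Z}_N=\mathbb{Z}/N\mathbb{Z}$; an element $c\in\mathbb{Z}_n$ is identified with an integer representative, and (for $g\mid n$) if $g\mid c$ then $c'=\frac cg$ is regarded as an element of $\mathbb{Z}_{n'}$, $n'=\frac ng$ (the divisibility and gcd conditions do not depend on the representative). For a positive integer $N$ and $a\in\mathbb{Z}_N$, the ideal (equivalently, cyclic additive subgroup) generated by $a$ in $\mathbb{Z}_N$ is $(a)=a\mathbb{Z}_N$, $\mathrm{ord}(a)=\frac{N}{(a,N)}$ is the additive order of $a$, and $$(a)^{\bigstar}:=\{ax:\ 1\le x\le \mathrm{ord}(a),\ (x,\mathrm{ord}(a))=1\}\subseteq\mathbb{Z}_N,$$ which is the set of all generators of $(a)$; in particular $\{0\}^{\bigstar}=\{0\}$. Every ideal $I$ of $\mathbb{Z}_N$ is principal, and $I^{\bigstar}:=(a)^{\bigstar}$ for any generator $a$ of $I$. For a nonzero ideal $I$, the leader $\mathrm{lead}(I)$ is the least non-negative residue mod $N$ among all generators of $I$; it is a divisor of $N$. In the theorem $(a)^{\bigstar},(b)^{\bigstar}$ are subsets of $\mathbb{Z}_n$, and $A+B:=\{u+v: u\in A, v\in B\}$. In the unions in (3), $d$ runs over positive divisors, $(d)^{\bigstar}$ is taken in $\mathbb{Z}_{n'}$, and $g(d)^{\bigstar}:=\{gx:\ x\in(d)^{\bigstar}\}\subseteq\mathbb{Z}_n$ (multiplication by $g$ being a well-defined map $\mathbb{Z}_{n'}\to\mathbb{Z}_n$).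 $N_{n;a,b}(c):=\#\{(u,v)\in (a)^{\bigstar}\times (b)^{\bigstar}:\ u+v=c\}$, the sets being taken in $\mathbb{Z}_n$. *)

(* Defs.v *)
From HB Require Import structures.
From mathcomp Require Import all_boot all_order all_algebra.

Set Implicit Arguments.
Unset Strict Implicit.
Unset Printing Implicit Defensive.

Import GRing.Theory.
Local Open Scope ring_scope.

(* The ring Z/NZ for N > 0, including the trivial ring when N = 1: the type   *)
(* 'Z_N cannot be used since 'Z_1 is Z/2Z.  MathComp has no ring instance on  *)
(* 'I_1, hence the explicit product Zp_mul; addition is the instance on 'I_k.+1. *)
Notation Zmod N := 'I_N.-1.+1.

Section ZmodIdeals.

Variable N : nat.
Implicit Types (a b x r : Zmod N) (I : {set Zmod N}).

Definition is_ideal I : Prop :=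
  [/\ 0 \in I,
      {in I &, forall x y, x + y \in I}
    & forall r, {in I, forall x, Zp_mul r x \in I}].

Definition pideal a : {set Zmod N} := [set Zp_mul a x | x : Zmod N].

Definition zord a : nat := (N %/ gcdn a N)%N.

Definition star a : {set Zmod N} :=
  [set a *+ x | x : 'I_(zord a).+1 & (0 < x)%N && coprime x (zord a)].

(* The chosen generator is irrelevant by star_generators below; sets that are *)
(* not principal ideals get the junk value set0.                              *)
Definition ideal_star I : {set Zmod N} :=
  if [pick a | pideal a == I] is Some a then star a else set0.

(* Least k < N whose class generates I (for I = 0 this is 0). *)
Definition lead I : nat :=
  find (fun k => pideal (inZp k) == I) (iota 0 N).

End ZmodIdeals.

Definition sumset N (A B : {set Zmod N}) : {set Zmod N} :=
  [set u + v | u in A, v in B].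

Definition Nsol (n a b : nat) (c : Zmod n) : nat :=
  #|[set p : Zmod n * Zmod n |
      [&& p.1 \in star (inZp a), p.2 \in star (inZp b) & p.1 + p.2 == c]]|.

(* The image in Z/nZ, under x |-> g x, of a subset of Z/(n/g)Z. *)
Definition dilate (n g : nat) (A : {set Zmod (n %/ g)}) : {set Zmod n} :=
  [set inZp (g * x)%N | x : Zmod (n %/ g) in A].

Definition max_coprime_divisor (m k : nat) : nat :=
  (\max_(d <- divisors m | coprime d k) d)%N.

Lemma mem_pideal N (a x : Zmod N) : (0 < N)%N ->
  (x \in pideal a) = (gcdn a N %| x)%N.
Proof.
case: N a x => // p a x _ /=; apply/imsetP/idP => [[y _ ->]|/dvdnP[q def_x]].
  rewrite /= /dvdn modn_dvdm ?dvdn_gcdr // -/(dvdn _ _).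
  by rewrite dvdn_mulr ?dvdn_gcdl.
have [a0 | a_gt0] := posnP a.
  exists 0 => //; apply/val_inj; rewrite /= a0 mul0n mod0n def_x a0 gcd0n.
  by move: (ltn_ord x); rewrite def_x a0 gcd0n; case: q {def_x} => // q;
    rewrite mulSn ltnNge leq_addr.
case: (egcdnP p.+1 a_gt0) => u v def_g _.
exists (inZp (u * q)) => //; apply/val_inj; rewrite /= modnMmr.
rewrite mulnA [(a * u)%N]mulnC mulnC def_g mulnDr mulnA modnMDl -def_x.
by rewrite modn_small.
Qed.

Lemma eq_pideal N (a x : Zmod N) : (0 < N)%N ->
  (pideal x == pideal a) = (gcdn x N == gcdn a N).
Proof.
move=> N_gt0; apply/eqP/eqP => [eq_xa | eq_g]; last first.
  by apply/setP=> y; rewrite !mem_pideal // eq_g.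
have self (y : Zmod N) : y \in pideal y by rewrite mem_pideal ?dvdn_gcdl.
have := self x; rewrite eq_xa mem_pideal // => dv1.
have := self a; rewrite -eq_xa mem_pideal // => dv2.
by apply/eqP; rewrite eqn_dvd !dvdn_gcd dv1 dv2 !dvdn_gcdr.
Qed.

Lemma star_generators N (a : Zmod N) : (0 < N)%N ->
  star a = [set x | pideal x == pideal a].
Proof.
move=> N_gt0; apply/setP=> x; rewrite inE eq_pideal // /star /zord.
case: N N_gt0 a x => // p _ a x /=.
set h := gcdn a p.+1; set o := (p.+1 %/ h)%N.
have h_gt0 : (0 < h)%N by rewrite gcdn_gt0 orbT.
have def_p : p.+1 = (o * h)%N by rewrite divnK ?dvdn_gcdr.
have def_a : nat_of_ord a = ((a %/ h) * h)%N by rewrite divnK ?dvdn_gcdl.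
set a1 := (a %/ h)%N in def_a.
have o_gt0 : (0 < o)%N by rewrite divn_gt0 // dvdn_leq ?dvdn_gcdr.
have co_a1 : coprime a1 o.
  have : gcdn a p.+1 = h by [].
  rewrite {1}def_a def_p -muln_gcdl => /eqP.
  by rewrite -[X in _ == X]mul1n eqn_pmul2r.
have valM k : nat_of_ord (a *+ k) = ((a * k) %% p.+1)%N.
  elim: k => [|k IHk]; first by rewrite muln0 mod0n.
  by rewrite mulrS /= IHk modnDmr mulnS.
apply/imsetP/eqP => [[k] | eq_g].
  rewrite inE => /andP[_ co_k] ->; rewrite valM gcdn_modl.
  rewrite def_a mulnAC def_p -muln_gcdl.
  have /eqP-> : coprime (a1 * k) o by rewrite coprimeMl co_a1.
  by rewrite mul1n.
have def_x : nat_of_ord x = ((x %/ h) * h)%N by rewrite divnK // -eq_g dvdn_gcdl.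
set x1 := (x %/ h)%N in def_x.
have co_x1 : coprime x1 o.
  move: eq_g; rewrite {1}def_x def_p -muln_gcdl => /eqP.
  by rewrite -[X in _ == X]mul1n eqn_pmul2r.
have [u eq_u] : exists u, a1 * u = 1 %[mod o].
  have [a10 | a1_gt0] := posnP a1.
    by exists 0; move: co_a1; rewrite a10 /coprime gcd0n => /eqP->; rewrite !modn1.
  case: (egcdnP o a1_gt0) => u v def_g _; exists u.
  by rewrite mulnC def_g (eqP co_a1) modnMDl.
have co_u : coprime u o.
  have : coprime (a1 * u) o by rewrite -coprime_modl eq_u coprime_modl coprime1n.
  by rewrite coprimeMl => /andP[].
pose k0 := (u * x1 %% o)%N; pose k := if k0 == 0 then o else k0.
have eq_k : k = u * x1 %[mod o].
  by rewrite /k; case: eqP => [k00|_]; [rewrite modnn; exact/esym | exact: modn_mod].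
have k_le : (k < o.+1)%N by rewrite /k; case: eqP => // _; rewrite ltnS ltnW ?ltn_mod.
exists (Ordinal k_le); last first.
  apply/val_inj; rewrite [RHS]valM /= -[LHS](modn_small (ltn_ord x)).
  rewrite def_x def_a def_p mulnAC -!muln_modl; congr (_ * _)%N.
  by rewrite -modnMmr eq_k modnMmr mulnA -modnMml eq_u modnMml mul1n.
rewrite inE /=; apply/andP; split; first by rewrite /k; case: eqP => // /eqP; rewrite lt0n.
by rewrite -coprime_modl eq_k coprime_modl coprimeMl co_u.
Qed.

(* Main.v *)
Require Import Defs.
From HB Require Import structures.
From mathcomp Require Import all_boot all_order all_algebra.

Set Implicit Arguments.
Unset Strict Implicit.
Unset Printing Implicit Defensive.

Import GRing.Theory.
Local Open Scope nat_scope.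

(** Write [n = g * n'], [a = g * a'], [b = g * b']; then [a'] and [b'] are
    coprime and [a' * b'] divides [n']. The set [star] of a divisor [d] of [N]
    consists of the residues [x] with [gcdn x N = d], so that [c] is a sum of an
    element of [star a] and one of [star b] exactly when [g] divides [c] and
    [a' * x + b' * y = c'] modulo [n'], with [c = g * c'], [x] coprime to
    [n %/ a] and [y] coprime to [n %/ b].

    Since [b'] divides [n %/ a] and [a'] divides [n %/ b], reducing modulo [a']
    and modulo [b'] shows that [c'] is coprime to [a' * b']. If [n'] is even and
    [a' * b'] is odd, then [x] and [y] are odd, hence [c'] is even. Conversely,
    under these conditions there is a solution in which [x] and [y] are both
    coprime to [n'] (coprime_linear_solution). The solutions of
    [a' * x = b' * w + c'] contain a line [(x + b' * t, w + a' * t)]; for each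
    prime divisor [p] of [n'] some [t] keeps both coordinates prime to [p]
    (ndvd_solution_line), and the Chinese remainder theorem yields one [t] for
    all [p]. Taking [y = - w] gives the criterion Nsol_gt0E, valid for both
    parities.

    Let [m] be the largest divisor of [n' %/ (a' * b')] coprime to [a' * b'].
    Then [c'] is coprime to [a' * b'] if and only if [gcdn c' n'] divides [m], and
    in that case [gcdn c' n' = gcdn c' m]. An ideal having [c'] as a generator is
    the ideal generated by [c'], and its leader is [gcdn c' n'] when [c'] is
    nonzero: this is the claim on leaders. Sorting the [c'] of the criterion by
    the value [d] of [gcdn c' n'] gives the decomposition of the sumset. *)

(** * Coprime solutions of a linear equation *)

Lemma prime_dvd_coprimeF p m k : prime p -> coprime m k -> p %| m -> ~~ (p %| k).
Proof.
move=> p_pr co_mk p_m; apply/negP=> p_k.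
have : p %| gcdn m k by rewrite dvdn_gcd p_m.
by rewrite (eqP co_mk) Euclid_dvd1.
Qed.

(** Moving along the line of solutions of [a * x = b * w + c], a prime [p] can
    be kept away from both coordinates at once. Two of the parameters [0], [1],
    [2] can make the same coordinate vanish modulo an odd [p] only if [p]
    divides [a * b]; in that case one coordinate never vanishes. For [p = 2] not
    dividing [a * b], there are only two values of [t] to choose from, and [c]
    has to be even. *)
Lemma ndvd_solution_line p a b c x w :
    prime p -> coprime a b -> coprime c (a * b) -> a * x = b * w + c ->
    (p = 2 -> (2 %| a * b) || (2 %| c)) ->
  exists t, ~~ (p %| x + b * t) && ~~ (p %| w + a * t).
Proof.
move=> p_pr co_ab; rewrite coprimeMr => /andP[co_ca co_cb] eq_xw even2.
have step y k i d : p %| y + k * i -> p %| y + k * (i + d) -> p %| k * d.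
  by move=> p_i; rewrite mulnDr addnA dvdn_addr.
have step01 y k : ~~ (p %| k) -> p %| y + k * 0 -> ~~ (p %| y + k * 1).
  by move=> p'k p_0; apply: contra p'k => /(step _ _ 0 1 p_0); rewrite muln1.
have [p_b | p'b] := boolP (p %| b).
  have p'a : ~~ (p %| a) by apply: prime_dvd_coprimeF p_b; rewrite // coprime_sym.
  have p'c : ~~ (p %| c) by apply: prime_dvd_coprimeF p_b; rewrite // coprime_sym.
  have p'x t : ~~ (p %| x + b * t).
    rewrite dvdn_addl ?dvdn_mulr //; apply: contra p'c => p_x.
    by rewrite -(dvdn_addr c (dvdn_mulr w p_b)) -eq_xw dvdn_mull.
  have [p_0 | p'0] := boolP (p %| w + a * 0); last by exists 0; rewrite p'x.
  by exists 1; rewrite p'x step01.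
have [p_a | p'a] := boolP (p %| a).
  have p'c : ~~ (p %| c) by apply: prime_dvd_coprimeF p_a; rewrite // coprime_sym.
  have p'w t : ~~ (p %| w + a * t).
    rewrite dvdn_addl ?dvdn_mulr //; apply: contra p'c => p_w.
    by rewrite -(dvdn_addr c (dvdn_mull b p_w)) -eq_xw dvdn_mulr.
  have [p_0 | p'0] := boolP (p %| x + b * 0); last by exists 0; rewrite p'w andbT.
  by exists 1; rewrite p'w step01.
have [p2 | p_neq2] := eqVneq p 2.
  have p_c : p %| c.
    by have := even2 p2; rewrite -p2 Euclid_dvdM // (negPf p'a) (negPf p'b).
  (* As p divides c but not a * b, both coordinates vanish modulo p together. *)
  have eq_xwt t : (p %| x + b * t) = (p %| w + a * t).
    have -> : (p %| x + b * t) = (p %| a * (x + b * t)).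
      by rewrite Euclid_dvdM // (negPf p'a).
    rewrite mulnDr eq_xw addnAC mulnCA -mulnDr dvdn_addl // Euclid_dvdM //.
    by rewrite (negPf p'b).
  have [p_0 | p'0] := boolP (p %| x + b * 0); last by exists 0; rewrite -eq_xwt andbb.
  by exists 1; rewrite -eq_xwt andbb step01.
have step02 y k : ~~ (p %| k) -> p %| y + k * 0 -> ~~ (p %| y + k * 2).
  move=> p'k p_0; apply: contra p'k => /(step _ _ 0 2 p_0).
  by rewrite Euclid_dvdM // (@dvdn_prime2 p 2) // (negPf p_neq2) orbF.
have step12 y k : ~~ (p %| k) -> p %| y + k * 1 -> ~~ (p %| y + k * 2).
  by move=> p'k p_1; apply: contra p'k => /(step _ _ 1 1 p_1); rewrite muln1.
have [p_x0 | p'x0] := boolP (p %| x + b * 0).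
  have [p_w1 | p'w1] := boolP (p %| w + a * 1); last by exists 1; rewrite step01.
  by exists 2; rewrite step02 ?step12.
have [p_w0 | p'w0] := boolP (p %| w + a * 0); last by exists 0; rewrite p'x0.
have [p_x1 | p'x1] := boolP (p %| x + b * 1); last by exists 1; rewrite p'x1 step01.
by exists 2; rewrite step12 ?step02.
Qed.

(** Chinese remaindering for conditions [Q p t] that depend on [t] only
    modulo [p]. *)
Lemma exists_crt_primes (s : seq nat) (Q : nat -> pred nat) :
    uniq s -> {in s, forall p, prime p} ->
    (forall p t u, t = u %[mod p] -> Q p t = Q p u) ->
    {in s, forall p, exists t, Q p t} ->
  exists t, {in s, forall p, Q p t}.
Proof.
move=> + + Qmod; elim: s => [|p s IHs] /=; first by exists 0.
case/andP=> p's uniq_s pr_s exQ.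
have [//|q s_q|q s_q|t Qt] := IHs.
- by apply: pr_s; rewrite inE s_q orbT.
- by apply: exQ; rewrite inE s_q orbT.
have [r Qr] := exQ p (mem_head p s).
pose P := \prod_(q <- s) q.
have co_pP : coprime p P.
  rewrite prime_coprime ?pr_s ?mem_head // Euclid_dvd_prod ?pr_s ?mem_head //.
  rewrite big_has; apply/hasPn=> q s_q.
  rewrite dvdn_prime2 ?pr_s ?mem_head // ?inE ?s_q ?orbT //.
  by apply: contraNneq p's => ->.
exists (chinese p P r t) => q; rewrite inE => /predU1P[-> | s_q].
  by rewrite (Qmod _ _ r) // chinese_modl.
have q_P : q %| P by rewrite /P (big_rem q) //= dvdn_mulr.
rewrite (Qmod _ _ t) ?Qt //.
by rewrite -(modn_dvdm _ q_P) chinese_modr // modn_dvdm.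
Qed.

Lemma coprime_primesP m n : 0 < n ->
  reflect {in primes n, forall p, ~~ (p %| m)} (coprime m n).
Proof.
move=> n_gt0; apply: (iffP idP) => [co_mn p | ndvd].
  rewrite mem_primes => /and3P[p_pr _ p_n].
  by apply: prime_dvd_coprimeF p_n; rewrite // coprime_sym.
have [m0 | m_gt0] := posnP m; last first.
  rewrite coprime_has_primes //; apply/hasPn=> p /ndvd.
  by apply: contra; rewrite /= mem_primes => /and3P[].
have [n1 | n_gt1] := leqP n 1.
  by rewrite (_ : n = 1) ?coprimen1 //; apply/eqP; rewrite eqn_leq n1.
have /ndvd : pdiv n \in primes n by rewrite mem_primes pdiv_prime // n_gt0 pdiv_dvd.
by rewrite m0 dvdn0.
Qed.

Lemma coprime_linear_solution n a b c :
    0 < n -> 0 < a -> coprime a b -> coprime c (a * b) ->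
    ((2 %| n) ==> (2 %| a * b) || (2 %| c)) ->
  exists x w, [/\ a * x = b * w + c, coprime x n & coprime w n].
Proof.
move=> n_gt0 a_gt0 co_ab co_c even2.
have [x [w eq_xw]] : exists x w, a * x = b * w + c.
  case: (egcdnP b a_gt0) => u v def_u _; exists (u * c), (v * c).
  by rewrite !mulnA mulnC [a * u]mulnC def_u (eqP co_ab) mulnC mulnDl mul1n [v * b]mulnC.
pose Q p t := ~~ (p %| x + b * t) && ~~ (p %| w + a * t).
have [||||t Qt] := @exists_crt_primes (primes n) Q.
- exact: primes_uniq.
- by move=> p; rewrite mem_primes => /andP[].
- move=> p t u eq_tu; rewrite /Q /dvdn -!(modnDmr _ (_ * _)) -!(modnMmr _ t).
  by rewrite eq_tu !modnMmr !modnDmr.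
- move=> p; rewrite mem_primes => /and3P[p_pr _ p_n].
  apply: (ndvd_solution_line p_pr co_ab co_c eq_xw) => p2.
  by move: even2; rewrite -p2 p_n.
exists (x + b * t), (w + a * t); split.
- by rewrite !mulnDr eq_xw addnAC mulnCA.
- by apply/coprime_primesP => // p /Qt/andP[].
- by apply/coprime_primesP => // p /Qt/andP[].
Qed.

(** * The largest divisor coprime to a given integer *)

Lemma max_coprime_divisorP q k : 0 < q ->
  [/\ max_coprime_divisor q k %| q, coprime (max_coprime_divisor q k) k
    & forall d, d %| q -> coprime d k -> d %| max_coprime_divisor q k].
Proof.
move=> q_gt0; set m := max_coprime_divisor q k.
have le_m d : d %| q -> coprime d k -> d <= m.
  by move=> d_q co_dk; apply: leq_bigmax_seq => //; rewrite -dvdn_divisors.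
have [m0 | /andP[m_q co_mk]] : m = 0 \/ (m %| q) && coprime m k.
  rewrite /m /max_coprime_divisor big_seq_cond.
  elim/big_ind: _ => [|x y Px Py|d /andP[]]; first by left.
    by rewrite /maxn; case: ifP.
  by rewrite -dvdn_divisors // => ? ?; right; apply/andP.
  by have := le_m 1 (dvd1n _) (coprime1n _); rewrite m0.
split=> // d d_q co_dk.
(* The least common multiple of m and d is again a divisor coprime to k. *)
have lcm_le : lcmn m d <= m.
  apply: le_m; first by rewrite dvdn_lcm m_q.
  apply: (@coprime_dvdl _ (m * d)); last by rewrite coprimeMl co_mk.
  by rewrite dvdn_lcm dvdn_mulr ?dvdn_mull.
have m_gt0 : 0 < m by apply: dvdn_gt0 m_q.
suff <- : lcmn m d = m by apply: dvdn_lcmr.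
by apply/eqP; rewrite eqn_leq lcm_le dvdn_leq ?dvdn_lcml // lcmn_gt0 m_gt0 (dvdn_gt0 q_gt0).
Qed.

(** When [k %| N], a divisor of [N] coprime to [k] divides [N %/ k]; this
    applies to [gcdn x N] if [x] is coprime to [k]. *)
Lemma gcdn_max_coprime_divisor N k x : 0 < N -> k %| N -> coprime x k ->
  gcdn x N = gcdn x (max_coprime_divisor (N %/ k) k).
Proof.
move=> N_gt0 k_N co_xk; have k_gt0 := dvdn_gt0 N_gt0 k_N.
have [|m_q _ m_max] := @max_coprime_divisorP (N %/ k) k.
  by rewrite divn_gt0 // dvdn_leq.
apply/eqP; rewrite eqn_dvd !dvdn_gcd !dvdn_gcdl /=.
rewrite (dvdn_trans (dvdn_gcdr x _) (dvdn_trans m_q (dvdn_div k_N))) andbT.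
have co_gk : coprime (gcdn x N) k by apply: coprime_dvdl co_xk; apply: dvdn_gcdl.
apply: m_max => //.
by rewrite -(Gauss_dvdl _ co_gk) divnK // dvdn_gcdr.
Qed.

Lemma coprime_max_coprime_divisor N k x : 0 < N -> k %| N ->
  coprime x k = (gcdn x N %| max_coprime_divisor (N %/ k) k).
Proof.
move=> N_gt0 k_N; have k_gt0 := dvdn_gt0 N_gt0 k_N.
have [|_ co_mk _] := @max_coprime_divisorP (N %/ k) k.
  by rewrite divn_gt0 // dvdn_leq.
apply/idP/idP => [co_xk | g_m].
  by rewrite (gcdn_max_coprime_divisor N_gt0 k_N co_xk) dvdn_gcdr.
rewrite /coprime -dvdn1 -(eqP co_mk) dvdn_gcd dvdn_gcdr andbT.
by apply: dvdn_trans g_m; rewrite dvdn_gcd dvdn_gcdl (dvdn_trans (dvdn_gcdr _ _)).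
Qed.

(** * Sums of integers with prescribed greatest common divisors *)

Lemma gcdnM_eql a x n : 0 < a -> (gcdn (a * x) (a * n) == a) = coprime x n.
Proof. by move=> a_gt0; rewrite -muln_gcdr -{2}(muln1 a) eqn_pmul2l. Qed.

(** Necessity is read off modulo [a], [b] and [2]; sufficiency is
    [coprime_linear_solution]. *)
Lemma sum_of_prescribed_gcds g n a b c :
    0 < g -> 0 < n -> coprime a b -> a * b %| n ->
  (exists u v, [/\ gcdn u (g * n) = g * a, gcdn v (g * n) = g * b
                 & u + v = c %[mod g * n]])
  <-> [&& g %| c, coprime (c %/ g) (a * b)
        & (2 %| n) ==> (2 %| a * b) || (2 %| c %/ g)].
Proof.
move=> g_gt0 n_gt0 co_ab /dvdnP[k def_n].
move: n_gt0; rewrite def_n !muln_gt0 => /and3P[k_gt0 a_gt0 b_gt0].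
have def_na : k * (a * b) = a * (k * b) by rewrite mulnCA.
have def_nb : k * (a * b) = b * (k * a) by rewrite mulnA mulnC.
split=> [[u [v [gcd_u gcd_v eq_uv]]] | ].
  have : g * a %| u by rewrite -gcd_u dvdn_gcdl.
  case/dvdnP=> u1 def_u; rewrite mulnC in def_u.
  have : g * b %| v by rewrite -gcd_v dvdn_gcdl.
  case/dvdnP=> v1 def_v; rewrite mulnC in def_v.
  move/eqP: gcd_u; rewrite def_u {1}def_na (mulnA g a) gcdnM_eql ?muln_gt0 ?g_gt0 //.
  rewrite coprimeMr => /andP[co_uk co_ub].
  move/eqP: gcd_v; rewrite def_v {1}def_nb (mulnA g b) gcdnM_eql ?muln_gt0 ?g_gt0 //.
  rewrite coprimeMr => /andP[co_vk co_va].
  move: eq_uv; rewrite def_u def_v -!mulnA -mulnDr.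
  move=> eq_c; have g_c : g %| c.
    rewrite /dvdn -(modn_dvdm c (dvdn_mulr (k * (a * b)) (dvdnn g))) -eq_c.
    by rewrite modn_dvdm ?dvdn_mulr // modnMr.
  move: eq_c; rewrite -{1}(divnK g_c) (mulnC _ g) -!muln_modr.
  move/eqP; rewrite eqn_pmul2l // => /eqP eq_c; rewrite g_c /=.
  set c1 := c %/ g in eq_c *.
  have red d : d %| k * (a * b) -> c1 = a * u1 + b * v1 %[mod d].
    by move=> d_n; rewrite -(modn_dvdm c1 d_n) -eq_c modn_dvdm.
  apply/andP; split.
    rewrite coprimeMr -[coprime c1 a]coprime_modl -[coprime c1 b]coprime_modl.
    have a_n : a %| k * (a * b) by rewrite def_na dvdn_mulr.
    have b_n : b %| k * (a * b) by rewrite def_nb dvdn_mulr.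
    rewrite (red a a_n) (red b b_n).
    rewrite [a * u1]mulnC modnMDl addnC [b * v1]mulnC modnMDl !coprime_modl.
    by rewrite !coprimeMl co_va co_ub co_ab coprime_sym co_ab.
  apply/implyP=> even_n; case: (boolP (2 %| a * b)) => //= odd_ab.
  rewrite /dvdn (red 2) // -/(dvdn _ _) dvdn2 oddD !oddM.
  move: even_n odd_ab; rewrite Euclid_dvdM // => /orP[even_k | ->] //.
  (* Since k is even, u1 and v1 are odd. *)
  have odd_co x : coprime x k -> odd x.
    by move=> co_xk; rewrite -coprimen2; apply: coprime_dvdr even_k co_xk.
  by rewrite dvdn2 negbK oddM (odd_co u1) // (odd_co v1) // => /andP[-> ->].
case/and3P=> g_c co_c even_c.
have n_gt0 : 0 < k * (a * b) by rewrite !muln_gt0 k_gt0 a_gt0.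
have [x [w [eq_xw co_x co_w]]] :=
  coprime_linear_solution n_gt0 a_gt0 co_ab co_c even_c.
(* Multiplying w by n - 1 turns it into its opposite modulo n. *)
exists (g * a * x), (g * b * ((k * (a * b)).-1 * w)); split.
- apply/eqP; rewrite {1}def_na (mulnA g a) gcdnM_eql ?muln_gt0 ?g_gt0 //.
  by apply: coprime_dvdr co_x; rewrite def_na dvdn_mull.
- apply/eqP; rewrite {2}def_nb (mulnA g b) gcdnM_eql ?muln_gt0 ?g_gt0 //.
  apply: (@coprime_dvdr _ (k * (a * b))); first by rewrite def_nb dvdn_mull.
  by rewrite coprimeMl coprimePn.
- rewrite -![g * _ * _]mulnA -mulnDr eq_xw -{2}(divnK g_c) [_ %/ g * g]mulnC -!muln_modr.
  congr (g * _); rewrite addnAC -mulnDr -mulSn prednK // [b * _]mulnCA.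
  by rewrite [_ * (b * w)]mulnC modnMDl.
Qed.

(** * Generators and ideals of the ring of residues *)

Lemma val_inZp N k : 0 < N -> nat_of_ord (inZp k : Zmod N) = k %% N.
Proof. by case: N. Qed.

Lemma ltn_Zmod N (x : Zmod N) : 0 < N -> x < N.
Proof. by case: N x => // N x _; apply: ltn_ord. Qed.

Lemma mem_star_inZp N d (x : Zmod N) : 0 < N -> d %| N ->
  (x \in star (inZp d : Zmod N)) = (gcdn x N == d).
Proof.
move=> N_gt0 d_N; rewrite star_generators // inE eq_pideal // val_inZp //.
by rewrite gcdn_modl (gcdn_idPl d_N).
Qed.

Lemma pideal_is_ideal N (a : Zmod N) : 0 < N -> is_ideal (pideal a).
Proof.
move=> N_gt0; case: N N_gt0 a => // N N_gt0 a.
split=> [|x y|r x]; rewrite !mem_pideal //=.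
- by move=> g_x g_y; rewrite /dvdn modn_dvdm ?dvdn_gcdr // -/(dvdn _ _) dvdn_add.
- by move=> g_x; rewrite /dvdn modn_dvdm ?dvdn_gcdr // -/(dvdn _ _) dvdn_mull.
Qed.

Lemma mem_ideal_star_pideal N (x : Zmod N) : 0 < N -> x \in ideal_star (pideal x).
Proof.
move=> N_gt0; rewrite /ideal_star; case: pickP => [a /eqP eq_a | /(_ x)/eqP//].
by rewrite star_generators // inE eq_a.
Qed.

Lemma ideal_star_gen N (I : {set Zmod N}) x : 0 < N ->
  x \in ideal_star I -> pideal x = I.
Proof.
move=> N_gt0; rewrite /ideal_star; case: pickP => [a /eqP <- | _]; last by rewrite inE.
by rewrite star_generators // inE => /eqP.
Qed.

Lemma lead_pideal N (x : Zmod N) : 0 < N -> 0 < x -> lead (pideal x) = gcdn x N.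
Proof.
move=> N_gt0 x_gt0; set h := gcdn x N.
have h_gt0 : 0 < h by rewrite gcdn_gt0 x_gt0.
have lt_hN : h < N by apply: leq_ltn_trans (ltn_Zmod x N_gt0); rewrite dvdn_leq ?dvdn_gcdl.
have def_p k : (pideal (inZp k : Zmod N) == pideal x) = (gcdn k N == h).
  by rewrite eq_pideal // val_inZp // gcdn_modl.
have def_iota : iota 0 N = iota 0 h ++ iota h (N - h).
  by rewrite -{1}(subnKC (ltnW lt_hN)) iotaD.
rewrite /lead (eq_find def_p) def_iota find_cat size_iota; case: hasP => [[k] | _].
  rewrite mem_iota => /andP[_ lt_kh] /eqP eq_kh.
  have [k0 | k_gt0] := posnP k; first by move: lt_hN; rewrite -eq_kh k0 gcd0n ltnn.
  by move: lt_kh; rewrite ltnNge -{1}eq_kh dvdn_leq ?dvdn_gcdl.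
have : 0 < N - h by rewrite subn_gt0.
case: (N - h) => //= m _; rewrite (gcdn_idPl _) ?eqxx ?addn0 //.
exact: dvdn_gcdr.
Qed.

(** The ideal is the one generated by the class of [c']; the hypothesis
    [c != 0] excludes the zero ideal, whose leader is [0]. *)
Lemma unique_ideal_gcd_lead n g k (c : Zmod n) (n' := n %/ g) (c' := c %/ g) :
    0 < n -> g %| n -> g %| c -> c != 0%R -> k %| n' -> coprime c' k ->
  exists2 I : {set Zmod n'},
    unique (fun J => is_ideal J /\ inZp c' \in ideal_star J) I
    & lead I = gcdn c' (max_coprime_divisor (n' %/ k) k).
Proof.
move=> n_gt0 g_n g_c c_neq0 k_n' co_c'k; have g_gt0 := dvdn_gt0 n_gt0 g_n.
have n'_gt0 : 0 < n' by rewrite divn_gt0 // dvdn_leq.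
have c_gt0 : 0 < c by rewrite lt0n.
have def_c' : nat_of_ord (inZp c' : Zmod n') = c'.
  by rewrite val_inZp // modn_small // ltn_divLR // divnK // ltn_Zmod.
exists (pideal (inZp c')); last first.
  rewrite lead_pideal // def_c' ?(gcdn_max_coprime_divisor n'_gt0 k_n') //.
  by rewrite divn_gt0 // dvdn_leq.
split; first by split; [apply: pideal_is_ideal | apply: mem_ideal_star_pideal].
by move=> J [_ /ideal_star_gen->].
Qed.

(** * Sums of two sets of generators *)

Lemma mem_sumset_star n a b (c : Zmod n) :
  (c \in sumset (star (inZp a)) (star (inZp b))) = (0 < Nsol a b c).
Proof.
rewrite /Nsol card_gt0; apply/imset2P/set0Pn => [[u v a_u b_v ->] | [[u v]]].
  by exists (u, v); rewrite inE a_u b_v eqxx.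
by rewrite inE => /and3P[a_u b_v /eqP <-]; exists u v.
Qed.

Lemma Nsol_gt0P n a b (c : Zmod n) : 0 < n -> a %| n -> b %| n ->
  0 < Nsol a b c <->
  exists u v, [/\ gcdn u n = a, gcdn v n = b & u + v = c %[mod n]].
Proof.
move=> n_gt0 a_n b_n; have valD (u v : Zmod n) : nat_of_ord (u + v)%R = (u + v) %% n.
  by case: n n_gt0 u v {a_n b_n c}.
rewrite -mem_sumset_star; split=> [/imset2P[u v] | [u [v [gcd_u gcd_v eq_uv]]]].
  rewrite !mem_star_inZp // => /eqP gcd_u /eqP gcd_v ->.
  by exists u, v; rewrite valD modn_mod.
apply/imset2P; exists (inZp u) (inZp v).
- by rewrite mem_star_inZp // val_inZp // gcdn_modl gcd_u.
- by rewrite mem_star_inZp // val_inZp // gcdn_modl gcd_v.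
- apply: val_inj; rewrite [RHS]valD !val_inZp // modnDm eq_uv modn_small //.
  exact: ltn_Zmod.
Qed.

Lemma divn_gcd_facts n a b (g := gcdn a b) : 0 < n -> a %| n -> b %| n ->
  [/\ 0 < g, g %| n, coprime (a %/ g) (b %/ g)
    & (a %/ g) * (b %/ g) %| n %/ g].
Proof.
move=> n_gt0 a_n b_n; have a_gt0 := dvdn_gt0 n_gt0 a_n.
have g_gt0 : 0 < g by rewrite gcdn_gt0 a_gt0.
have [g_a g_b] : g %| a /\ g %| b by rewrite dvdn_gcdl dvdn_gcdr.
have g_n := dvdn_trans g_a a_n.
have co_ab : coprime (a %/ g) (b %/ g).
  by rewrite /coprime -(eqn_pmul2r g_gt0) muln_gcdl !divnK // mul1n.
split=> //; rewrite Gauss_dvd // -(dvdn_pmul2r g_gt0) !divnK // a_n.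
by rewrite -(dvdn_pmul2r g_gt0) !divnK.
Qed.

(** Both parities are covered at once: the last condition is void unless
    [n %/ g] is even and [(a %/ g) * (b %/ g)] is odd, when it says that
    [c %/ g] is even. *)
Lemma Nsol_gt0E n a b (c : Zmod n) (g := gcdn a b) :
    0 < n -> a %| n -> b %| n ->
  (0 < Nsol a b c) = [&& g %| c, coprime (c %/ g) ((a %/ g) * (b %/ g))
    & (2 %| n %/ g) ==> (2 %| (a %/ g) * (b %/ g)) || (2 %| c %/ g)].
Proof.
move=> n_gt0 a_n b_n; have [g_gt0 g_n co_ab ab_n] := divn_gcd_facts n_gt0 a_n b_n.
have n'_gt0 : 0 < n %/ g by rewrite divn_gt0 // dvdn_leq.
have := sum_of_prescribed_gcds c g_gt0 n'_gt0 co_ab ab_n.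
rewrite ![g * _]mulnC !divnK ?dvdn_gcdl ?dvdn_gcdr // => sumP.
by apply/idP/idP => [/(Nsol_gt0P c n_gt0 a_n b_n)/sumP | /sumP/(Nsol_gt0P c n_gt0 a_n b_n)].
Qed.

Lemma mem_dilate_star n g d (z : Zmod n) : 0 < n -> g %| n -> d %| n %/ g ->
  (z \in dilate (star (inZp d : Zmod (n %/ g))))
    = (g %| z) && (gcdn (z %/ g) (n %/ g) == d).
Proof.
move=> n_gt0 g_n d_n'; have g_gt0 := dvdn_gt0 n_gt0 g_n.
have n'_gt0 : 0 < n %/ g by rewrite divn_gt0 // dvdn_leq.
apply/imsetP/andP => [[x] | [g_z gcd_z]].
  rewrite mem_star_inZp // => gcd_x ->; rewrite val_inZp // modn_small.
    by rewrite dvdn_mulr // mulKn.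
  by rewrite mulnC -ltn_divRL // ltn_Zmod.
have lt_z : z %/ g < n %/ g by rewrite ltn_divLR // divnK // ltn_Zmod.
exists (inZp (z %/ g)); first by rewrite mem_star_inZp // val_inZp // modn_small.
apply: val_inj; rewrite [RHS]val_inZp // [X in _ * X]val_inZp // (modn_small lt_z).
by rewrite mulnC divnK // modn_small // ltn_Zmod.
Qed.

Lemma mem_bigcup_dilate n g m (P : pred nat) (z : Zmod n) :
    0 < n -> g %| n -> m %| n %/ g -> let h := gcdn (z %/ g) (n %/ g) in
  (z \in \bigcup_(d <- divisors m | P d) dilate (star (inZp d : Zmod (n %/ g))))
    = [&& g %| z, h %| m & P h].
Proof.
move=> n_gt0 g_n m_n' h; have g_gt0 := dvdn_gt0 n_gt0 g_n.
have m_gt0 : 0 < m.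
  by apply: dvdn_gt0 m_n'; rewrite divn_gt0 // dvdn_leq.
rewrite (big_morph (fun A : {set Zmod n} => z \in A) (in_setU z) (in_set0 z)).
rewrite big_has_cond; apply/hasP/and3P => [[d] | [g_z h_m Ph]].
  rewrite -dvdn_divisors // => d_m /= /andP[Pd].
  rewrite mem_dilate_star // ?(dvdn_trans d_m) // => /andP[g_z /eqP def_d].
  by rewrite /h def_d.
exists h; first by rewrite -dvdn_divisors.
by rewrite /= Ph mem_dilate_star ?dvdn_gcdr // g_z eqxx.
Qed.

Theorem theorem3p2 (n a b : nat) (c : Zmod n)
    (n_gt0 : 0 < n) (a_dvd_n : a %| n) (b_dvd_n : b %| n) :
  let g := gcdn a b in
  let n' := n %/ g in
  let a' := a %/ g in
  let b' := b %/ g in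
  let c' := c %/ g in
  let m3 := max_coprime_divisor (n' %/ (a' * b')) (a' * b') in
  (~~ (2 %| n') \/ 2 %| a' * b' ->
    [/\ 0 < Nsol a b c <-> g %| c /\ coprime c' (a' * b'),
        c != 0%R -> 0 < Nsol a b c ->
          exists2 I : {set Zmod n'},
            unique (fun J => is_ideal J /\ inZp c' \in ideal_star J) I
            & lead I = gcdn c' m3
      & sumset (star (inZp a : Zmod n)) (star (inZp b : Zmod n)) =
          \bigcup_(d <- divisors m3) dilate (star (inZp d : Zmod n'))])
  /\
  (2 %| n' /\ ~~ (2 %| a' * b') ->
    [/\ 0 < Nsol a b c <-> [/\ g %| c, 2 %| c' & coprime c' (a' * b')],
        c != 0%R -> 0 < Nsol a b c ->
          exists2 I : {set Zmod n'},
            unique (fun J => is_ideal J /\ inZp c' \in ideal_star J) I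
            & lead I = gcdn c' m3
      & sumset (star (inZp a : Zmod n)) (star (inZp b : Zmod n)) =
          \bigcup_(d <- divisors m3 | 2 %| d) dilate (star (inZp d : Zmod n'))]).

Proof.
move=> g n' a' b' c' m3.
have [g_gt0 g_n _ ab_n'] := divn_gcd_facts n_gt0 a_dvd_n b_dvd_n.
rewrite -/g -/n' -/a' -/b' in g_gt0 g_n ab_n'.
have n'_gt0 : 0 < n' by rewrite divn_gt0 // dvdn_leq.
have ab_gt0 : 0 < a' * b' := dvdn_gt0 n'_gt0 ab_n'.
have NsolE z := Nsol_gt0E z n_gt0 a_dvd_n b_dvd_n.
rewrite -/g -/n' -/a' -/b' in NsolE.
have m3_n' : m3 %| n'.
  have [|m3_q _ _] := @max_coprime_divisorP (n' %/ (a' * b')) (a' * b').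
    by rewrite divn_gt0 // dvdn_leq.
  exact: dvdn_trans m3_q (dvdn_div ab_n').
have part2 : c != 0%R -> 0 < Nsol a b c ->
    exists2 I : {set Zmod n'},
      unique (fun J => is_ideal J /\ inZp c' \in ideal_star J) I
      & lead I = gcdn c' m3.
  move=> c_neq0; rewrite NsolE => /and3P[g_c co_c _].
  exact: unique_ideal_gcd_lead.
split=> [parity | [even_n' odd_ab]].
  have void z : (2 %| n') ==> (2 %| a' * b') || (2 %| z).
    by case: parity => [/negPf-> | ->]; rewrite ?implybT.
  split=> //; first by rewrite NsolE void andbT; split=> /andP.
  apply/setP=> z; rewrite mem_sumset_star NsolE void mem_bigcup_dilate //.
  by rewrite (coprime_max_coprime_divisor _ n'_gt0 ab_n').
split=> //; first rewrite NsolE even_n' (negPf odd_ab) /= -/c'.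
  by split=> [/and3P[] | [-> -> ->]].
apply/setP=> z; rewrite mem_sumset_star NsolE mem_bigcup_dilate //.
rewrite even_n' (negPf odd_ab) (coprime_max_coprime_divisor _ n'_gt0 ab_n').
by rewrite dvdn_gcd even_n' andbT.
Qed.
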